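(* Let $\mathcal{S}=(V,\mathcal{B})$ be a Steiner triple system. Then $\mathcal{S}$ admits an upper embedding in every orientation of triples. That is, for every choice, for each triple $B=\{u,v,w\}\in\mathcal{B}$, of one of the two cyclic permutations $(u,v,w)$, $(u,w,v)$, there exists an upper embedding of $\mathcal{S}$ in an oriented surface $\Sigma$ such that the orientation of $\Sigma$ induces the chosen cyclic permutation on every triple $B\in\mathcal{B}$.
   Context: A (partial) triple system $\mathcal{X}=(V,\mathcal{B})$ consists of a finite point set $V$ and a collection $\mathcal{B}$ of $3$-element subsets of $V$ (called blocks or triples) such that every $2$-element subset of $V$ is contained in at most one triple of $\mathcal{B}$. Its associated graph $K$ has vertex set $V$ and edges all pairs $uv$ of distinct points such that $\{u,v\}$ is a subset of some block; thus $\mathcal{B}$ is a decomposition of the edge set of $K$ into triangles. A Steiner triple system of order $n$ is a triple system with $|V|=n$ in which every $2$-element subset of $V$ is contained in exactly one block, so that its associated graph is the complete graph $K_n$. An embedding of a triple system $\mathcal{X}=(V,\mathcal{B})$ with connected associated graph $K$ is a cellular embedding $\vartheta: K\to\Sigma$ in a (closed, connected) orientable surface $\Sigma$ (cellular: every face is an open disc) such that every triangle $B\in\mathcal{B}$ bounds a face of $\vartheta$, called the block face of $B$ (one designated face for each block). The remaining faces are called outer faces. Every edge lies on the boundary of exactly one block face. An upper embedding is an embedding of $\mathcal{X}$ with exactly one outer face. An orientation of a triple $\{u,v,w\}$ is one of the two cyclic permutations $(u,v,w)$, $(u,w,v)$. In an embedding of $\mathcal{X}$ in an oriented surface $\Sigma$,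 the orientation of $\Sigma$ induces on each triple $B=\{u,v,w\}$ the cyclic permutation in which $u,v,w$ appear around the centre of the triangular block face of $B$ when going round in the sense of the orientation of $\Sigma$. *)

(* Defs.v *)
From HB Require Import structures.
From mathcomp Require Import all_boot all_fingroup.
Set Implicit Arguments.
Unset Strict Implicit.
Unset Printing Implicit Defensive.

Definition triple_system (V : finType) (B : {set {set V}}) : Prop :=
  (forall b, b \in B -> #|b| = 3) /\
  (forall e : {set V}, #|e| = 2 -> #|[set b in B | e \subset b]| <= 1).

Definition steiner_triple_system (V : finType) (B : {set {set V}}) : Prop :=
  triple_system B /\
  (forall e : {set V}, #|e| = 2 -> #|[set b in B | e \subset b]| = 1).

(* The associated graph K of (V, B). *)
Definition adj (V : finType) (B : {set {set V}}) : rel V :=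
  fun u v => (u != v) && [exists b in B, [set u; v] \subset b].

Lemma adj_sym (V : finType) (B : {set {set V}}) u v : adj B u v = adj B v u.
Proof. by rewrite /adj eq_sym setUC. Qed.

(* The null graph is not counted as connected: a surface is nonempty, and all
   its faces under a cellular embedding are discs. *)
Definition connected_graph (V : finType) (e : rel V) : Prop :=
  0 < #|V| /\ forall u v, connect e u v.

(* Edges of K with a direction of travel. *)
Record dart (V : finType) (B : {set {set V}}) : Type := Dart {
  ends : V * V;
  ends_adj : adj B ends.1 ends.2
}.

HB.instance Definition _ (V : finType) (B : {set {set V}}) :=
  [isSub for @ends V B].
HB.instance Definition _ (V : finType) (B : {set {set V}}) :=
  [Finite of dart B by <:].

Definition tail (V : finType) (B : {set {set V}}) (d : dart B) : V :=
  (ends d).1.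
Definition head (V : finType) (B : {set {set V}}) (d : dart B) : V :=
  (ends d).2.

Lemma rev_dart_proof (V : finType) (B : {set {set V}}) (d : dart B) :
  adj B (head d) (tail d).
Proof. by rewrite adj_sym; exact: (ends_adj d). Qed.

Definition rev_dart (V : finType) (B : {set {set V}}) (d : dart B) : dart B :=
  @Dart V B (head d, tail d) (rev_dart_proof d).

Lemma rev_dartK (V : finType) (B : {set {set V}}) :
  involutive (@rev_dart V B).
Proof. by move=> [[u v] uv]; apply: val_inj. Qed.

Definition rev_perm (V : finType) (B : {set {set V}}) : {perm dart B} :=
  perm (inv_inj (@rev_dartK V B)).

(* Cellular embeddings of K in closed connected oriented surfaces, up to
   orientation-preserving homeomorphism, in the Heffter-Edmonds encoding:
   rot d is the dart following d around its tail in the sense of the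
   orientation of the surface. The surface is recovered by gluing one disc
   along each facial walk (see faces). *)
Record cellular_embedding (V : finType) (B : {set {set V}}) : Type := {
  graph_connected : connected_graph (adj B);
  rot : {perm dart B};
  rot_cyclic : forall d d' : dart B,
    (d' \in porbit rot d) = (tail d' == tail d)
}.

(* The dart following d on the facial walk, directed so that it goes around
   the centre of the face in the sense of the orientation: with rot read as
   counterclockwise, the face lies on the left of d, and so the walk continues
   with the dart preceding rev_dart d around head d. *)
Definition face_perm (V : finType) (B : {set {set V}})
    (E : cellular_embedding B) : {perm dart B} :=
  (rev_perm B * (rot E)^-1)%g.

Lemma tail_face_perm (V : finType) (B : {set {set V}})
    (E : cellular_embedding B) (d : dart B) :
  tail (face_perm E d) = head d.
Proof.
have -> : face_perm E d = (rot E)^-1%g (rev_dart d).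
  by rewrite permM (_ : rev_perm B d = rev_dart d) // permE.
apply/eqP; rewrite -[head d]/(tail (rev_dart d)) -(rot_cyclic E) -porbitV.
by have := mem_porbit (rot E)^-1%g 1 (rev_dart d); rewrite expg1.
Qed.

(* A face is given by the set of darts on its facial walk. A connected graph
   without darts is a single vertex in the sphere, which has one face, with
   no darts. *)
Definition faces (V : finType) (B : {set {set V}})
    (E : cellular_embedding B) : {set {set dart B}} :=
  if #|{: dart B}| == 0 then [set set0] else porbits (face_perm E).

(* The facial walk of F is u -> v -> w -> u, where b = {u, v, w}. *)
Definition bounds (V : finType) (B : {set {set V}})
    (E : cellular_embedding B) (b : {set V}) (F : {set dart B}) : Prop :=
  F \in faces E /\
  exists u v w : V, [/\ uniq [:: u; v; w], b = [set u; v; w] &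
    [set (tail d, head d) | d in F] = [set (u, v); (v, w); (w, u)]].

(* block_face is data: if a single triple is embedded in the sphere, both faces
   are bounded by it. Distinct blocks have distinct block faces by
   block_faceP. Values outside B are irrelevant. *)
Record embedding (V : finType) (B : {set {set V}}) : Type := {
  emb :> cellular_embedding B;
  block_face : {set V} -> {set dart B};
  block_faceP : forall b, b \in B -> bounds emb b (block_face b)
}.

Definition outer_faces (V : finType) (B : {set {set V}}) (E : embedding B) :
    {set {set dart B}} :=
  faces E :\: [set block_face E b | b in B].

Definition upper_embedding (V : finType) (B : {set {set V}})
    (E : embedding B) : Prop :=
  #|outer_faces E| = 1.

(* s is a cyclic permutation of the points of b (and fixes all others). *)
Definition cyclic_perm_of (V : finType) (b : {set V}) (s : {perm V}) : Prop :=
  perm_on b s /\ forall x, x \in b -> porbit s x = b.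

(* o b is the chosen orientation of the block b. *)
Definition triple_orientation (V : finType) (B : {set {set V}})
    (o : {set V} -> {perm V}) : Prop :=
  forall b, b \in B -> cyclic_perm_of b (o b).

(* The points of b, read around the centre of its block face in the sense of
   the orientation of the surface, follow each other as under s. *)
Definition induces (V : finType) (B : {set {set V}}) (E : embedding B)
    (b : {set V}) (s : {perm V}) : Prop :=
  forall d, d \in block_face E b -> s (tail d) = tail (face_perm E d).

(* Main.v *)
Require Import Defs.
From mathcomp Require Import all_boot all_fingroup.
From mathcomp Require Import zify.
(* Restores head as the end of a dart, which seq shadows. *)
Import Defs.
Set Implicit Arguments.
Unset Strict Implicit.
Unset Printing Implicit Defensive.

(** Call a pair (x, b) of a block b and a point x of b a flag; the prescribed
    orientations turn the flags of each block in a 3-cycle, and let tau be the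
    product of these 3-cycles. In an embedding that induces the orientations,
    the rotation at a point x visits the blocks through x in some cyclic order,
    which can be chosen freely. If rho permutes the flags so that its cycles
    are these orders, the outer faces correspond to the cycles of tau * rho. So
    the theorem says: for some rho whose cycles are the sets of all flags at
    one point, tau * rho has a single cycle. Equivalently, the incidence graph
    of points and blocks, whose edges are the flags, has an embedding with one
    face in which the rotation at every block is prescribed.

    The argument is that of Xuong. The edges of a spanning tree of the incidence
    graph are inserted first; each of them joins two cycles of tau * rho
    (one_face_forest). The remaining edges are then inserted in pairs with a
    common point: inserting the first edge of a pair cuts the single cycle in
    two, and the freedom at the point allows the second edge to join them again
    (one_face_pair, one_face_complete). This needs a spanning tree that misses
    an even number of edges at every point.

    Such a tree is made of the star of a point u, that is, all edges on the
    blocks through u, and of one edge (a b, b) for each block b that avoids u.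
    What is left is to choose a so that every point x lies on an even number of
    blocks b avoiding u with a b <> x (even_selection); call x even or odd
    according to the parity of this number over the blocks treated so far. Take
    a block {u, y, z} and let W be the set of the other points. The other blocks
    through y, and likewise those through z, match the points of W in pairs. The
    union of two perfect matchings is bipartite (two_matchings_bipartite), so
    some S meets every pair of both matchings in one point. Fix a arbitrarily on
    the blocks inside W, except that some point x0 of W must be even, and take S
    to be the one of the two colour classes that contains x0. The blocks through
    z can be used to make every point of S odd, and the block of x0 then leaves
    a choice, which is used to make z even. Each block through y now has an odd
    point in W, and one of its three choices makes both its points in W even.
    Finally y is even because the total is twice the number of blocks. *)

(** * Orbits and transpositions *)

Section Orbits.
Variable T : finType.
Implicit Types (s : {perm T}) (A Z : {set T}).

Lemma porbit_sub s A x :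
  (forall z, z \in A -> s z \in A) -> x \in A -> porbit s x \subset A.
Proof.
move=> sA xA; apply/subsetP => _ /porbitP[i ->].
elim: i => [|i IHi]; first by rewrite expg0 perm1.
by rewrite expgSr permM sA.
Qed.

Lemma porbit_step s x z : (s z \in porbit s x) = (z \in porbit s x).
Proof. by rewrite -!eq_porbit_mem -(porbit_perm s 1 z) expg1. Qed.

Lemma eq_in_porbit s s' x :
  (forall z, z \in porbit s x -> s' z = s z) -> porbit s' x = porbit s x.
Proof.
move=> ss'; have E i : (s' ^+ i)%g x = (s ^+ i)%g x.
  elim: i => [|i IHi]; first by rewrite !expg0.
  by rewrite !expgSr !permM IHi ss' ?mem_porbit.
by apply/setP => y; apply/porbitP/porbitP => -[i ->]; exists i.
Qed.

Lemma porbit_fix s x : s x = x -> porbit s x = [set x].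
Proof.
move=> sx; apply/eqP; rewrite eqEsubset sub1set porbit_id andbT.
by apply: porbit_sub => [z /set1P->|]; rewrite ?sx set11.
Qed.

(** A transposition changes the number of orbits by one. It cannot separate x
    and y, or leave them separate, both times: a second multiplication gives s
    back, and the two changes must cancel. *)
Lemma mem_porbit_mul_tperm s x y : x != y ->
  (x \in porbit (s * tperm x y)%g y) = (x \notin porbit s y).
Proof.
move=> xy.
have porbitsC (u : {perm T}) :
    #|porbits (tperm x y * u^-1)%g| = #|porbits (u * tperm x y)%g|.
  by rewrite -porbitsV invMg tpermV invgK.
have := porbits_mul_tperm s^-1 x y; rewrite /= porbitsC porbitsV porbitV xy.
have := porbits_mul_tperm (s * tperm x y)^-1 x y.
rewrite /= porbitsC -mulgA tperm2 mulg1 porbitsV porbitV xy.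
by do 2 case: (_ \in _) => /=; rewrite ?addn0 //; lia.
Qed.

Lemma porbit_mul_tperm s x y : x \notin porbit s y ->
  porbit (s * tperm x y)%g x = porbit s x :|: porbit s y.
Proof.
move=> xNy; have xy : x != y by apply: contraNneq xNy => ->; apply: porbit_id.
have yx : y \in porbit (s * tperm x y)%g x.
  by rewrite porbit_sym mem_porbit_mul_tperm.
apply/eqP; rewrite eqEsubset subUset; apply/andP; split; last first.
  have closed z : z \in porbit (s * tperm x y)%g x ->
      s z \in porbit (s * tperm x y)%g x.
    rewrite -porbit_step permM; case: tpermP => [->|->|] //.
    by rewrite porbit_id.
  by rewrite !porbit_sub ?porbit_id.
apply: porbit_sub => [z|]; last by rewrite inE porbit_id.
rewrite permM !inE -(porbit_step s x) -(porbit_step s y).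
by case: tpermP => [-> _|-> _|_ _ //]; rewrite porbit_id ?orbT.
Qed.

Lemma porbit_mul_tperm_other s x y z :
  z \notin porbit s x -> z \notin porbit s y ->
  porbit (s * tperm x y)%g z = porbit s z.
Proof.
move=> zx zy; apply: eq_in_porbit => w wz; rewrite permM tpermD //.
  by apply: contraNneq zx => ->; rewrite porbit_sym porbit_step.
by apply: contraNneq zy => ->; rewrite porbit_sym porbit_step.
Qed.
End Orbits.

(** * One-face embeddings built edge by edge *)

Section OneFace.
Variables (T : finType) (V : eqType) (p : T -> V) (tau : {perm T}).
Implicit Types (A C Z : {set T}) (rho : {perm T}).

(** A state of the construction: the elements of A, the edges inserted so
    far, are in the rotations of their points; any other edge is still pendant
    and has an end of its own, which makes it a fixed point of rho. *)
Definition rotation_on A rho : Prop :=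
  (forall x, x \in A -> porbit rho x = [set y in A | p y == p x]) /\
  (forall x, x \notin A -> rho x = x).

(** Z is the set of the flags on the blocks connected so far; every other block
    still forms a component of its own. *)
Definition one_face A Z : Prop :=
  exists rho, [/\ A \subset Z, rotation_on A rho &
    forall x, x \in Z -> porbit (tau * rho)%g x = Z].

(** The pendant edge f enters the rotation at its point next to g. *)
Lemma rotation_on_insert A rho f g : rotation_on A rho ->
  f \notin A -> g \in A -> p f = p g ->
  rotation_on (f |: A) (rho * tperm f g)%g.
Proof.
move=> [rhoA rhoNA] fA gA pfg; have rf := rhoNA f fA.
have of_ := porbit_fix rf.
have fNg : f \notin porbit rho g by rewrite rhoA // inE (negPf fA).
have new : porbit (rho * tperm f g)%g f = [set y in f |: A | p y == p f].
  rewrite porbit_mul_tperm // of_ rhoA //; apply/setP => y; rewrite !inE pfg.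
  by case: eqVneq => //= ->; rewrite pfg eqxx.
split=> x; last first.
  rewrite !inE negb_or => /andP[xf xA]; rewrite permM rhoNA // tpermD //.
    by rewrite eq_sym.
  by apply: contraNneq xA => <-.
have [xf xA|pxf xA] := eqVneq (p x) (p f).
  have : x \in porbit (rho * tperm f g)%g f by rewrite new inE xA xf eqxx.
  by rewrite -eq_porbit_mem => /eqP->; rewrite new xf.
have xNf : x != f by apply: contraNneq pxf => ->.
move: xA; rewrite !inE (negPf xNf) /= => xA.
rewrite porbit_mul_tperm_other.
- rewrite rhoA //; apply/setP => y; rewrite !inE.
  by case: (eqVneq y f) => //= ->; rewrite (negPf fA) eq_sym (negPf pxf).
- by rewrite of_ inE.
by rewrite porbit_sym rhoA // inE gA -pfg eq_sym.
Qed.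

Lemma one_face_start x : one_face [set x] (porbit tau x).
Proof.
exists 1%g; split; first by rewrite sub1set porbit_id.
  split=> y; last by rewrite perm1.
  move=> /set1P->; rewrite porbit_fix ?perm1 //; apply/setP => z.
  by rewrite !inE; case: eqVneq => //= ->; rewrite eqxx.
by move=> y; rewrite mulg1 -eq_porbit_mem => /eqP.
Qed.

(** An edge that is the first one at its point is the whole rotation there,
    so it can be declared inserted without any change of rho. *)
Lemma one_face_new_points A C Z : one_face A Z -> C \subset Z ->
  (forall f g, f \in C -> g \in A :|: C -> p f = p g -> f = g) ->
  one_face (A :|: C) Z.
Proof.
move=> [rho [AZ [rhoA rhoNA] ZZ]] CZ new; exists rho; split=> //.
  by rewrite subUset AZ.
split=> x; rewrite !inE; last by rewrite negb_or => /andP[/rhoNA].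
have [xA _|xA /= xC] := boolP (x \in A).
  rewrite rhoA //; apply/setP => y; rewrite !inE.
  have [//|yA /=] := boolP (y \in A); apply/esym/negbTE/negP => /andP[yC /eqP].
  by move/(new y x yC _)=> yx; move: yA; rewrite yx ?xA // inE xA.
rewrite porbit_fix ?rhoNA //; apply/setP => y; rewrite !inE.
apply/eqP/andP => [->|[yAC /eqP pyx]]; first by rewrite xC orbT.
by rewrite (new x y) // inE.
Qed.

(** Outside Z every edge is pendant, so tau * rho acts there as tau and the
    cycle of f is that of its block; the transposition joins it to Z. *)
Lemma one_face_tree_edge A Z f g : one_face A Z ->
  f \notin Z -> g \in A -> p f = p g ->
  one_face (f |: A) (Z :|: porbit tau f).
Proof.
move=> [rho [AZ rot ZZ]] fZ gA pfg; have [rhoA rhoNA] := rot.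
have gZ := subsetP AZ g gA.
have fA : f \notin A by apply: contra fZ; apply: (subsetP AZ).
exists (rho * tperm f g)%g; split.
- rewrite subUset sub1set inE porbit_id orbT.
  by apply: subset_trans AZ _; apply: subsetUl.
- exact: rotation_on_insert.
have fNg : f \notin porbit (tau * rho)%g g by rewrite ZZ.
have of_ : porbit (tau * rho)%g f = porbit tau f.
  apply: esym; apply: eq_in_porbit => z zf.
  suff zA : (tau * rho)%g z \notin A.
    by apply: (@perm_inj _ rho); rewrite (rhoNA _ zA) permM.
  apply: contra fZ => /(subsetP AZ) zZ.
  by rewrite -(ZZ _ zZ) porbit_sym porbit_step.
move=> x xZ; have E : porbit (tau * (rho * tperm f g))%g f = Z :|: porbit tau f.
  by rewrite mulgA porbit_mul_tperm // of_ ZZ // setUC.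
by rewrite -[RHS]E; apply/eqP; rewrite eq_porbit_mem E.
Qed.

(** Inserting f1 next to g cuts Z into the cycle of f1 and that of g. The
    element f2 is in one of the two, and at their common point it can be
    inserted next to whichever of f1 and g lies in the other one. *)
Lemma one_face_pair A Z f1 f2 g : one_face A Z ->
  f1 \in Z -> f2 \in Z -> f1 != f2 -> f1 \notin A -> f2 \notin A ->
  g \in A -> p f1 = p g -> p f2 = p g -> one_face (f2 |: (f1 |: A)) Z.
Proof.
move=> [rho [AZ rot ZZ]] f1Z f2Z f12 f1A f2A gA pf1 pf2.
have gZ := subsetP AZ g gA.
have f1g : f1 != g by apply: contraNneq f1A => ->.
have rot1 := rotation_on_insert rot f1A gA pf1.
have f2A1 : f2 \notin f1 |: A by rewrite !inE negb_or f2A eq_sym f12.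
have AZ2 : f2 |: (f1 |: A) \subset Z by rewrite !subUset !sub1set f1Z f2Z.
set phi := (tau * (rho * tperm f1 g))%g.
have f1Ng : f1 \notin porbit phi g.
  by rewrite /phi mulgA mem_porbit_mul_tperm // ZZ // negbK.
have split_Z : porbit phi f1 :|: porbit phi g = Z.
  rewrite -porbit_mul_tperm // /phi -!mulgA tperm2 mulg1.
  exact: ZZ.
have merge h : h \in f1 |: A -> p f2 = p h ->
    porbit phi f2 :|: porbit phi h = Z -> f2 \notin porbit phi h ->
    one_face (f2 |: (f1 |: A)) Z.
  move=> hA pf2h Zh f2h; exists (rho * tperm f1 g * tperm f2 h)%g; split=> //.
    exact: rotation_on_insert.
  have E : porbit (tau * (rho * tperm f1 g * tperm f2 h))%g f2 = Z.
    by rewrite mulgA porbit_mul_tperm.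
  by move=> x; rewrite -{1}E -eq_porbit_mem => /eqP->.
have [f2g|f2g] := boolP (f2 \in porbit phi g).
  have Ef2 : porbit phi f2 = porbit phi g by apply/eqP; rewrite eq_porbit_mem.
  apply: (merge f1); rewrite ?setU11 ?pf1 // ?Ef2 1?setUC // porbit_sym Ef2 //.
apply: (merge g); rewrite ?inE ?gA ?orbT //.
suff -> : porbit phi f2 = porbit phi f1 by [].
by apply/eqP; move: f2Z; rewrite eq_porbit_mem -split_Z inE (negPf f2g) orbF.
Qed.

(** The edges of C can be inserted one after the other: the block at the end of
    each stays separate from Z while the others are inserted. *)
Lemma one_face_forest A C Z : one_face A Z ->
  (forall f, f \in C -> f \notin Z /\ exists2 g, g \in A & p f = p g) ->
  (forall f f', f \in C -> f' \in C -> f' \in porbit tau f -> f = f') ->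
  one_face (A :|: C) (Z :|: \bigcup_(f in C) porbit tau f).
Proof.
move: {2}#|C| (leqnn #|C|) => n; elim: n C => [|n IHn] C leCn AZ CZ Cinj.
  have -> : C = set0 by apply/eqP; rewrite -cards_eq0 -leqn0.
  by rewrite big_set0 !setU0.
have [->|[f fC]] := set_0Vmem C; first by rewrite big_set0 !setU0.
have AZ' : one_face (A :|: C :\ f) (Z :|: \bigcup_(h in C :\ f) porbit tau h).
  apply: IHn => //.
  - by move: leCn; rewrite (cardsD1 f) fC.
  - by move=> h /setD1P[_ /CZ].
  by move=> h h' /setD1P[_ hC] /setD1P[_ h'C]; apply: Cinj.
have [fZ [g gA pfg]] := CZ f fC.
have -> : A :|: C = f |: (A :|: C :\ f) by rewrite setUCA setD1K.
rewrite (big_setD1 f fC) /= (setUC (porbit tau f)) (setUA Z).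
apply: (one_face_tree_edge AZ' _ _ pfg); last by rewrite inE gA.
rewrite inE (negPf fZ) /=; apply/bigcupP => -[h /setD1P[hf hC] fh].
by rewrite (Cinj h f) ?eqxx in hf.
Qed.

(** The parity condition splits the missing edges into pairs with a common
    point. *)
Lemma one_face_complete A Z : one_face A Z ->
  (forall f, f \in Z -> exists2 g, g \in A & p f = p g) ->
  (forall f, ~~ odd #|[set h in Z :\: A | p h == p f]|) ->
  one_face Z Z.
Proof.
move: {2}#|Z :\: A| (leqnn #|Z :\: A|) => n; elim: n A => [|n IHn] A.
  rewrite leqn0 cards_eq0 setD_eq0 => ZA AZ _ _; have [_ [AZs _ _]] := AZ.
  by rewrite {1}(_ : Z = A) //; apply/eqP; rewrite eqEsubset ZA.
move=> leZAn AZ pA even_p.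
have [/eqP ZA0|[f1 f1ZA]] := set_0Vmem (Z :\: A).
  by apply: IHn AZ pA even_p; rewrite (eqP ZA0) cards0.
set F := [set h in Z :\: A | p h == p f1].
have f1F : f1 \in F by rewrite inE f1ZA eqxx.
have [F0|[f2]] := set_0Vmem (F :\ f1).
  by have := even_p f1; rewrite -/F (cardsD1 f1) f1F F0 cards0.
rewrite !inE => /and3P[f21 /andP[f2A f2Z] /eqP pf21].
move: (f1ZA); rewrite inE => /andP[f1A f1Z].
have [g gA pf1] := pA f1 f1Z.
set A' := f2 |: (f1 |: A).
have AZ' : one_face A' Z.
  apply: (one_face_pair AZ f1Z f2Z _ _ _ gA pf1) => //; first by rewrite eq_sym.
  by rewrite pf21.
have ZA' : Z :\: A = f1 |: (f2 |: (Z :\: A')).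
  apply/setP=> h; rewrite !inE; case: (eqVneq h f1) => [->|] /=.
    by rewrite f1Z f1A.
  by case: (eqVneq h f2) => [->|] /=; rewrite ?f2Z ?f2A.
have f2ZA' : f2 \notin Z :\: A' by rewrite !inE eqxx.
have f1ZA' : f1 \notin f2 |: (Z :\: A').
  by rewrite !inE eqxx /= orbT orbF eq_sym f21.
apply: (IHn _ _ AZ').
- by move: leZAn; rewrite ZA' !cardsU1 f1ZA' f2ZA'; lia.
- by move=> h /pA[g' g'A ->]; exists g'; rewrite // !inE g'A !orbT.
move=> f; have := even_p f.
have count X : #|[set h in X | p h == p f]| = \sum_(h in X) (p h == p f).
  by rewrite -sum1dep_card big_mkcondr; apply: eq_bigr => h _; case: (_ == _).
rewrite !count ZA' !big_setU1 //= pf21 addnA addnn oddD odd_double.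
by [].
Qed.
End OneFace.

(** * Bipartiteness of the union of two matchings *)

Definition matching_on (T : finType) (W : {set T}) (alpha : T -> T) : Prop :=
  forall x, x \in W -> [/\ alpha x \in W, alpha x != x & alpha (alpha x) = x].

(** The union is a disjoint union of cycles that alternate between alpha and
    beta. With f = beta o alpha, each of them consists of two f-orbits, which
    both alpha and beta exchange; alpha cannot fix an orbit because of
    alpha (f x) = f^-1 (alpha x): if alpha x = f^k x, stepping from x to f x
    lowers k by two, down to a fixed point of alpha or beta. The colour
    compares the rank of the orbit of x with that of alpha x. *)
Lemma two_matchings_bipartite (T : finType) (W : {set T})
    (alpha beta : T -> T) :
  matching_on W alpha -> matching_on W beta ->
  exists c : T -> bool, forall x, x \in W ->
    c (alpha x) = ~~ c x /\ c (beta x) = ~~ c x.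
Proof.
move=> aW bW; pose f x := beta (alpha x).
have fW x : x \in W -> f x \in W by move=> /aW[/bW[]].
have fK x : x \in W -> alpha (beta (f x)) = x.
  move=> xW; have [axW _ axK] := aW x xW.
  by rewrite /f; have [_ _ ->] := bW _ axW.
have alpha_f k x : x \in W -> alpha x != iter k f x.
  elim/ltn_ind: k x => -[|[|k]] IHk x xW; have [axW axx axK] := aW x xW.
  - exact: axx.
  - by have [_ bax _] := bW _ axW; rewrite eq_sym.
  apply: contra (IHk k (leqW (leqnn _)) (f x) (fW x xW)) => /eqP axk.
  have iW j : iter j f (f x) \in W by elim: j => [|j /fW]; first exact: fW.
  rewrite -[iter k f (f x)]fK // -iterS; rewrite -/(f x) /=.
  have -> : f (iter k f (f x)) = alpha x by rewrite axk -iterS -iterSr.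
  by rewrite eqxx.
pose g x := if x \in W then f x else x.
have g_inj : injective g.
  move=> x x'; rewrite /g; case: ifP => xW; case: ifP => x'W // E.
  - by rewrite -(fK x) // E fK.
  - by rewrite -E fW in x'W.
  by rewrite E fW in xW.
pose O x := porbit (perm g_inj) x.
have Of x : x \in W -> O (f x) = O x.
  move=> xW; apply/eqP; rewrite eq_porbit_mem.
  by have := mem_porbit (perm g_inj) 1 x; rewrite expg1 permE /g xW.
have Oalpha x : x \in W -> O (alpha x) != O x.
  move=> xW; rewrite eq_porbit_mem; apply/porbitP => -[k].
  have -> : (perm g_inj ^+ k)%g x = iter k f x.
    suff [//] : (perm g_inj ^+ k)%g x = iter k f x /\ iter k f x \in W.
    elim: k => [|k [IHk iW]]; first by rewrite expg0 perm1.
    by rewrite expgSr permM IHk permE /g iW /= fW.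
  by apply/eqP/alpha_f.
exists (fun x => enum_rank (O x) < enum_rank (O (alpha x))) => x xW.
have [axW _ axK] := aW x xW; have [bxW _ bxK] := bW x xW.
have [abxW _ abxK] := aW _ bxW.
have <- : O (alpha x) = O (beta x) by rewrite -Of // /f axK.
have -> : O (alpha (beta x)) = O x by rewrite -Of // /f abxK bxK.
suff : (enum_rank (O (alpha x)) : nat) != enum_rank (O x).
  by rewrite axK -leqNgt ltn_neqAle => ->.
by rewrite val_eqE (inj_eq enum_rank_inj) Oalpha.
Qed.

(** * A selection of flags with even degrees *)

Section Steiner.
Variables (V : finType) (B : {set {set V}}).
Hypothesis SB : steiner_triple_system B.
Implicit Types (x y z : V) (b : {set V}) (C : {set {set V}}) (a : {set V} -> V).

Definition block x y : {set V} :=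
  odflt set0 [pick b in B | [set x; y] \subset b].

Lemma card_block b : b \in B -> #|b| = 3.
Proof. by case: SB => -[H _] _ /H. Qed.

Lemma blockP x y : x != y ->
  [/\ block x y \in B, x \in block x y & y \in block x y].
Proof.
move=> xy; rewrite /block; case: pickP => [b /andP[bB]|none].
  by rewrite subUset !sub1set => /andP[].
have [_ /(_ [set x; y])] := SB; rewrite cards2 xy => /(_ erefl).
rewrite (_ : [set b in B | _] = set0) ?cards0 //.
by apply/setP => b; rewrite !inE none.
Qed.

Lemma block_uniq b x y : b \in B -> x \in b -> y \in b -> x != y ->
  b = block x y.
Proof.
move=> bB xb yb xy; have [b'B xb' yb'] := blockP xy.
have [_ /(_ [set x; y])] := SB; rewrite cards2 xy => /(_ erefl).
move=> /eqP/cards1P[d Ed].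
have inE' e : e \in B -> x \in e -> y \in e -> e = d.
  by move=> eB xe ye; apply/set1P; rewrite -Ed inE eB subUset !sub1set xe.
by rewrite (inE' b) // (inE' (block x y)).
Qed.

Definition third x y : V := odflt x [pick z in block x y :\: [set x; y]].

Lemma thirdP x y : x != y ->
  [/\ block x y = [set x; y; third x y], third x y != x & third x y != y].
Proof.
move=> xy; have [bB xb yb] := blockP xy.
have xyb : [set x; y] \subset block x y by rewrite subUset !sub1set xb.
have card1 : #|block x y :\: [set x; y]| == 1.
  by rewrite cardsD (setIidPr xyb) cards2 xy card_block.
case/cards1P: card1 => z Ez.
have Et : third x y = z.
  by rewrite /third Ez; case: pickP => [t /set1P //|/(_ z)]; rewrite inE eqxx.
have : z \in [set z] by rewrite inE.
rewrite -Ez !inE negb_or Et => /andP[/andP[zx zy] zb]; split=> //.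
by rewrite -(setID (block x y) [set x; y]) (setIidPr xyb) Ez.
Qed.

Lemma third_block x y : x != y -> third x y \in block x y.
Proof. by move=> /thirdP[-> _ _]; rewrite !inE eqxx orbT. Qed.

Lemma third_uniq b x y z : b \in B -> x \in b -> y \in b -> z \in b ->
  x != y -> z != x -> z != y -> z = third x y.
Proof.
move=> bB xb yb zb xy zx zy; have [E _ _] := thirdP xy; move: zb.
by rewrite (block_uniq bB xb yb xy) E !inE (negPf zx) (negPf zy) => /eqP.
Qed.

Lemma thirdK x y : x != y -> third x (third x y) = y.
Proof.
move=> xy; have [bB xb yb] := blockP xy; have [_ tx ty] := thirdP xy.
by apply/esym/(third_uniq bB); rewrite ?third_block // 1?eq_sym.
Qed.

(** The number of edges at x outside the tree in the incidence graph if every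
    block b of C is attached to the tree by its point a b only. *)
Definition cotree_deg C a x := #|[set b in C | (x \in b) && (a b != x)]|.

Lemma eq_cotree_deg C a a' x : {in C, a =1 a'} ->
  cotree_deg C a x = cotree_deg C a' x.
Proof.
move=> aa'; congr #|pred_of_set _|; apply/setP => b; rewrite !inE.
by case: (boolP (b \in C)) => // /aa' ->.
Qed.

Lemma cotree_deg_off C a x y :
  (forall b, b \in C -> x \in b -> y \notin b) ->
  cotree_deg C a x = cotree_deg [set b in C | y \notin b] a x.
Proof.
move=> Cxy; congr #|pred_of_set _|; apply/setP => b; rewrite !inE.
case: (boolP (b \in C)) => //= bC; case: (boolP (x \in b)) => [xb|]; last first.
  by rewrite andbF.
by rewrite Cxy.
Qed.

Lemma cotree_deg_split C a x y : C \subset B -> x != y -> block y x \in C ->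
  cotree_deg C a x =
    (a (block y x) != x) + cotree_deg [set b in C | y \notin b] a x.
Proof.
move=> /subsetP CB; rewrite eq_sym => yx bC; have [bB yb xb] := blockP yx.
rewrite /cotree_deg (cardsD1 (block y x)) inE bC xb /=; congr (_ + _).
congr #|pred_of_set _|; apply/setP => b; rewrite !inE.
case: (boolP (b \in C)) => [bC'|_] /=; last by rewrite andbF.
case: (boolP (x \in b)) => [xb'|_]; last by rewrite !andbF.
congr (_ && _); apply/idP/idP => [|yb']; last first.
  by apply: contraNneq yb' => ->.
by apply: contra => yb'; apply/eqP/block_uniq => //; apply: CB.
Qed.

(** Each block of C has two edges outside the tree. *)
Lemma sum_cotree_deg C a : C \subset B -> {in C, forall b, a b \in b} ->
  \sum_x cotree_deg C a x = #|C|.*2.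
Proof.
move=> /subsetP CB aC; rewrite /cotree_deg.
under eq_bigr => x _ do rewrite -sum1dep_card big_mkcondr.
rewrite exchange_big /= -muln2 -sum_nat_const; apply: eq_bigr => b bC.
rewrite -big_mkcond sum1dep_card; have := card_block (CB b bC).
rewrite (cardsD1 (a b)) aC // => -[<-]; congr #|pred_of_set _|.
by apply/setP => x; rewrite !inE andbC eq_sym.
Qed.

Lemma third_matching z (W : {set V}) :
  (forall x, x \in W -> z != x /\ third z x \in W) -> matching_on W (third z).
Proof.
move=> zW x xW; have [zx tW] := zW x xW; have [_ _ tx] := thirdP zx.
by split; rewrite ?thirdK.
Qed.

Lemma cotree_deg_change C a a' b0 x : b0 \in C -> x \in b0 ->
  a b0 != x -> a' b0 = x -> (forall b, b != b0 -> a' b = a b) ->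
  cotree_deg C a x = (cotree_deg C a' x).+1.
Proof.
move=> b0C xb0 ab0 a'b0 aa'.
rewrite /cotree_deg (cardsD1 b0) inE b0C xb0 ab0 /= add1n; congr _.+1.
congr #|pred_of_set _|; apply/setP => b; rewrite !inE.
by case: (eqVneq b b0) => [->|/aa' -> //]; rewrite a'b0 eqxx !andbF.
Qed.

(** If all points of W are odd, changing the selected point of a single block
    makes one of them even. *)
Lemma initial_selection C (W : {set V}) : C \subset B -> W != set0 ->
  exists a x, [/\ {in C, forall b, a b \in b}, x \in W &
    ~~ odd (cotree_deg C a x)].
Proof.
move=> /subsetP CB /set0Pn[x xW].
pose a b := odflt x [pick y in b].
have aC : {in C, forall b, a b \in b}.
  move=> b bC; rewrite /a; case: pickP => // none.
  by have := card_block (CB b bC); rewrite eq_card0.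
have [odd_x|even_x] := boolP (odd (cotree_deg C a x)); last by exists a, x.
have /card_gt0P[b0] : 0 < cotree_deg C a x by case: cotree_deg odd_x.
rewrite inE => /and3P[b0C xb0 ab0].
pose a' b := if b == b0 then x else a b.
exists a', x; split=> //.
  by move=> b bC; rewrite /a'; case: eqP => [->|_] //; apply: aC.
rewrite (@cotree_deg_change C a a' b0) // in odd_x; first by rewrite /a' eqxx.
by move=> b /negPf bb0; rewrite /a' bb0.
Qed.

(** The selection is a0 on the blocks inside W; a1 extends it to the blocks
    through z, where every point of S becomes odd and z even, and a extends it
    to the blocks through y. *)
Lemma even_selection u :
  exists a, {in [set b in B | u \notin b], forall b, a b \in b} /\
    forall x, ~~ odd (cotree_deg [set b in B | u \notin b] a x).
Proof.
set C2 := [set b in B | u \notin b].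
have [->|[b2]] := set_0Vmem C2.
  exists (fun=> u); split=> [b|x]; first by rewrite inE.
  rewrite /cotree_deg (_ : [set b in _ | _] = set0) ?cards0 //.
  by apply/setP => b; rewrite !inE.
rewrite inE => /andP[b2B ub2].
have [y yb2] : exists y, y \in b2 by apply/card_gt0P; rewrite card_block.
have uy : u != y by apply: contraNneq ub2 => ->.
have [L0B uL0 yL0] := blockP uy.
pose z := third u y; have [L0E zu zy] := thirdP uy; rewrite -/z in L0E zu zy.
have zL0 : z \in block u y by apply: third_block.
set L0 := block u y in L0B uL0 yL0 zL0 L0E.
pose C1 := [set b in C2 | y \notin b]; pose C0 := [set b in C1 | z \notin b].
have C2B : C2 \subset B by apply/subsetP => b; rewrite inE => /andP[].
have C1B : C1 \subset B.
  by apply/subsetP => b; rewrite inE => /andP[/(subsetP C2B)].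
have C0B : C0 \subset B.
  by apply/subsetP => b; rewrite inE => /andP[/(subsetP C1B)].
pose W := ~: L0.
have off b v w x : b \in B -> v \in b -> x \in b -> x \in W ->
    v \in L0 -> w \in L0 -> w != v -> w \notin b.
  move=> bB vb xb xW vL0 wL0 wv; apply/negP => wb; move: xW.
  have E : b = L0.
    by rewrite (block_uniq bB wb vb wv) (block_uniq L0B wL0 vL0 wv).
  by rewrite inE -E xb.
have W0 : W != set0.
  apply: contra ub2 => /eqP W0; suff -> : b2 = L0 by [].
  apply/eqP; rewrite eqEcard !card_block // leqnn andbT.
  by rewrite -[L0]setCK -/W W0 setC0 subsetT.
have vW v x : v \in L0 -> x \in W -> v != x /\ third v x \in W.
  move=> vL0 xW; have vx : v != x.
    by apply: contraTneq xW => <-; rewrite inE vL0.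
  have [bB vb xb] := blockP vx; have tb := third_block vx.
  have [_ tx tv] := thirdP vx; split=> //; rewrite inE; apply/negP => tL0.
  by have := off _ v _ x bB vb xb xW vL0 tL0 tx; rewrite tb.
have [c cW] := two_matchings_bipartite
  (third_matching (fun x => @vW y x yL0))
  (third_matching (fun x => @vW z x zL0)).
have {}cW v x : v \in L0 -> v != u -> x \in W -> c (third v x) = ~~ c x.
  move=> vL0 /negPf vu xW; have [cy cz] := cW x xW.
  by move: vL0; rewrite L0E !inE vu /= => /orP[]/eqP->.
have [a0 [x0 [a0C0 x0W even_x0]]] := initial_selection C0B W0.
pose S x := (x \in W) && (c x == c x0).
(* The point of S on b, for a block b through y or z that avoids u. *)
pose rep b := odflt u [pick x in b | S x].
have repE v x : v \in L0 -> v != u -> S x -> rep (block v x) = x.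
  move=> vL0 vu /andP[xW cx]; have [vx txW] := vW v x vL0 xW.
  have [bB vb xb] := blockP vx; have Stx := cW v x vL0 vu xW.
  rewrite /rep; case: pickP => [t /andP[tb /andP[tW ct]]|/(_ x)]; last first.
    by rewrite /S xb xW cx.
  apply/eqP; apply: contraTT ct => tx.
  rewrite (_ : t = third v x) ?Stx ?(eqP cx); first by case: (c x0).
  apply: (third_uniq bB) => //.
  by apply: contraTneq tW => ->; rewrite inE vL0.
have S_third v x : v \in L0 -> v != u -> x \in W -> ~~ S x -> S (third v x).
  move=> vL0 vu xW; have [_ txW] := vW v x vL0 xW.
  by rewrite /S xW txW cW //=; case: (c x); case: (c x0).
have cover v b : v \in L0 -> v != u -> b \in C2 -> v \in b ->
    exists2 x, S x & b = block v x.
  move=> vL0 vu; rewrite inE => /andP[bB ub] vb.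
  have /subsetPn[x xb xL0] : ~~ (b \subset L0).
    apply: contra ub => bL0; suff -> : b = L0 by [].
    by apply/eqP; rewrite eqEcard bL0 !card_block.
  have xW : x \in W by rewrite inE.
  have [vx _] := vW v x vL0 xW; have Eb := block_uniq bB vb xb vx.
  have [Sx|NSx] := boolP (S x); first by exists x.
  exists (third v x); first exact: S_third.
  apply: block_uniq => //; first by rewrite Eb third_block.
  by have [_ _] := thirdP vx; have [_ + _] := thirdP vx; rewrite eq_sym.
(* On a block {z, x, t} with x in S, selecting x leaves the parity of x as it
   is, and selecting t or z changes it. The block of x0 can take either of
   these last two as d, and this decides the parity of z. *)
pose a1 d b :=
    if z \in b then
      if odd (cotree_deg C0 a0 (rep b)) then rep b
      else if b == block z x0 then d else third z (rep b)
    else a0 b.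
have a1E d x : S x -> a1 d (block z x) =
    if odd (cotree_deg C0 a0 x) then x
    else if block z x == block z x0 then d else third z x.
  move=> Sx; have [xW _] := andP Sx; have [zx _] := vW z x zL0 xW.
  by have [_ zb _] := blockP zx; rewrite /a1 zb repE // eq_sym.
have zx0 : z != x0 by have [] := vW z x0 zL0 x0W.
have [b0B zb0 x0b0] := blockP zx0.
have in_C1 x : x \in W -> block z x \in C1.
  move=> xW; have [zx _] := vW z x zL0 xW; have [bB zb xb] := blockP zx.
  by rewrite !inE bB !(off _ z _ x) // eq_sym.
have a1C0 d : cotree_deg C0 (a1 d) =1 cotree_deg C0 a0.
  move=> x; apply: eq_cotree_deg => b; rewrite inE => /andP[_ /negPf zb].
  by rewrite /a1 zb.
have [_ t0x0 t0z] := thirdP zx0.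
have [d d_b0 [dx0 even_z]] : exists2 d, d \in block z x0 &
    d != x0 /\ ~~ odd (cotree_deg C1 (a1 d) z).
  have [odd_z|even_z] :=
    boolP (odd (cotree_deg C1 (a1 (third z x0)) z)); last first.
    by exists (third z x0); rewrite ?third_block.
  exists z => //; split=> //.
  have Sx0 : S x0 by rewrite /S x0W eqxx.
  rewrite (@cotree_deg_change C1 _ (a1 z) (block z x0)) // in odd_z.
  - exact: in_C1.
  - by rewrite a1E // (negPf even_x0) eqxx.
  - by rewrite a1E // (negPf even_x0) eqxx.
  by move=> b /negPf bb0; rewrite /a1 bb0.
have odd_S x : S x -> odd (cotree_deg C1 (a1 d) x).
  move=> Sx; have [xW _] := andP Sx; have [zx _] := vW z x zL0 xW.
  have xz : x != z by rewrite eq_sym.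
  rewrite (cotree_deg_split _ C1B xz (in_C1 x xW)) -/C0 a1C0 a1E //.
  have [|even_x] := ifP; first by rewrite eqxx oddD => ->.
  rewrite oddD even_x addbF oddb; have [Eb|_] := eqVneq (block z x).
    suff -> : x = x0 by [].
    by rewrite -(repE z x) // Eb repE // /S x0W eqxx.
  by have [_ _ tx] := thirdP zx.
have a1C1 : {in C1, forall b, a1 d b \in b}.
  move=> b bC1; move: (bC1); rewrite inE => /andP[bC2 yb]; rewrite /a1.
  have [zb|zb] := boolP (z \in b); last by apply: a0C0; rewrite inE bC1.
  have [x Sx ->] := cover z b zL0 zu bC2 zb; rewrite repE //.
  have [xW _] := andP Sx; have [zx _] := vW z x zL0 xW.
  have [_ _ xb] := blockP zx; case: ifP => // _; case: eqP => [->//|_].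
  exact: third_block.
(* On a block {y, x, t} with x in S, the point x is odd and must change:
   so t is selected if it is even, and y if t has to change as well. *)
pose a b :=
  if y \in b then
    if odd (cotree_deg C1 (a1 d) (third y (rep b))) then y else third y (rep b)
  else a1 d b.
have yu : y != u by rewrite eq_sym.
have aE x : S x -> a (block y x) =
    if odd (cotree_deg C1 (a1 d) (third y x)) then y else third y x.
  move=> Sx; have [xW _] := andP Sx; have [yx _] := vW y x yL0 xW.
  by have [_ yb _] := blockP yx; rewrite /a yb repE.
have aC1 : cotree_deg C1 a =1 cotree_deg C1 (a1 d).
  move=> x; apply: eq_cotree_deg => b; rewrite inE => /andP[_ /negPf yb].
  by rewrite /a yb.
have aC2 : {in C2, forall b, a b \in b}.
  move=> b bC2; rewrite /a.
  have [yb|yb] := boolP (y \in b); last by apply: a1C1; rewrite inE bC2.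
  have [x Sx ->] := cover y b yL0 yu bC2 yb; rewrite repE //.
  have [xW _] := andP Sx; have [yx _] := vW y x yL0 xW.
  by have [_ yb' _] := blockP yx; case: ifP => // _; apply: third_block.
have deg_W x : x \in W -> cotree_deg C2 a x =
    (a (block y x) != x) + cotree_deg C1 (a1 d) x.
  move=> xW; have [yx _] := vW y x yL0 xW; have [bB yb xb] := blockP yx.
  have xy : x != y by rewrite eq_sym.
  have bC2 : block y x \in C2 by rewrite inE bB (off _ y _ x).
  by rewrite (cotree_deg_split _ C2B xy bC2) -/C1 aC1.
have even_off x : x != y -> ~~ odd (cotree_deg C2 a x).
  move=> xy; have [xW|xL0] := boolP (x \in W).
    have [yx txW] := vW y x yL0 xW; rewrite deg_W //.
    have [_ tx ty] := thirdP yx; have [Sx|NSx] := boolP (S x).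
      rewrite aE // oddD (odd_S x) // addbT negbK oddb.
      by case: ifP => _.
    have St := S_third y x yL0 yu xW NSx; rewrite oddD.
    have -> : block y x = block y (third y x).
      have [bB yb xb] := blockP yx.
      by apply: block_uniq; rewrite ?third_block // eq_sym.
    rewrite aE // thirdK //.
    by case: ifP => E; rewrite oddb ?yx ?eqxx ?E.
  move: xL0; rewrite inE negbK L0E !inE (negPf xy) orbF => /orP[]/eqP->.
    rewrite /cotree_deg (_ : [set b in _ | _] = set0) ?cards0 //.
    by apply/setP => b; rewrite !inE; case: (u \in b); rewrite ?andbF.
  rewrite (@cotree_deg_off _ _ _ y) -/C1 ?aC1 // => b.
  rewrite inE => /andP[bB ub] zb; apply: contra ub => yb.
  rewrite (block_uniq bB yb zb) 1?eq_sym //.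
  by rewrite -(block_uniq L0B yL0 zL0) // eq_sym.
exists a; split=> // x; have [->|/even_off//] := eqVneq x y.
have := sum_cotree_deg C2B aC2; rewrite (bigD1 y) //= => E.
have : ~~ odd (\sum_(i | i != y) cotree_deg C2 a i).
  elim/big_ind: _ => // m n; rewrite oddD.
  by move=> /negPf-> /negPf->.
by move: (congr1 odd E); rewrite odd_double oddD; case: odd => //= ->.
Qed.
End Steiner.

(** * Flags as darts *)

Section Darts.
Variables (V : finType) (B : {set {set V}}) (o : {set V} -> {perm V}).
Hypotheses (SB : steiner_triple_system B) (oP : triple_orientation B o).
Implicit Types (x y : V) (b : {set V}) (d e : dart B).

Lemma orient_in b x : b \in B -> x \in b -> o b x \in b.
Proof.
move=> /oP[_ ob] xb; have : o b x \in porbit (o b) x.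
  by rewrite porbit_step porbit_id.
by rewrite ob.
Qed.

Lemma orient3 b x : b \in B -> x \in b -> o b (o b (o b x)) = x.
Proof.
move=> bB xb; have [_ ob] := oP bB.
by have := iter_porbit (o b) x; rewrite ob // (card_block SB).
Qed.

Lemma mem_block_orient b x y : b \in B -> x \in b ->
  (y \in b) = (y \in [:: x; o b x; o b (o b x)]).
Proof.
move=> bB xb; have [_ ob] := oP bB.
by have := porbit_traject (o b) x y; rewrite ob // (card_block SB).
Qed.

Lemma orient_uniq b x : b \in B -> x \in b ->
  uniq [:: x; o b x; o b (o b x)].
Proof.
move=> bB xb; have [_ ob] := oP bB.
by have := uniq_traject_porbit (o b) x; rewrite ob // (card_block SB).
Qed.

Lemma orient_eq b x y : b \in B -> x \in b -> y \in b -> x != y ->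
  (o b y == x) = (o b x != y).
Proof.
move=> bB xb; rewrite (mem_block_orient y bB xb) !inE.
have := orient_uniq bB xb.
rewrite /= !inE negb_or andbT => /andP[/andP[x1 x2] x3].
case/or3P => /eqP-> xy; rewrite ?orient3 // ?eqxx ?x3 //.
  by rewrite eqxx in xy.
by rewrite eq_sym (negPf x2).
Qed.

Lemma adj_steiner x y : adj B x y = (x != y).
Proof.
rewrite /adj andb_idr // => xy; apply/existsP; exists (block B x y).
by have [-> xb yb] := blockP SB xy; rewrite subUset !sub1set xb.
Qed.

Lemma dart_neq d : tail d != head d.
Proof. by rewrite -adj_steiner; apply: ends_adj. Qed.

Lemma dart_inj d e : tail d = tail e -> head d = head e -> d = e.
Proof.
case: d e => -[x y] xy [[x' y'] xy'] /= Ex Ey; apply: val_inj => /=.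
by rewrite /tail /head /= in Ex Ey; rewrite Ex Ey.
Qed.

Definition dart_block d := block B (tail d) (head d).

Lemma dart_blockP d :
  [/\ dart_block d \in B, tail d \in dart_block d & head d \in dart_block d].
Proof. exact/blockP/dart_neq. Qed.

Lemma dart_block_rev d : dart_block (rev_dart d) = dart_block d.
Proof.
have [dB td hd] := dart_blockP d.
by apply/esym/block_uniq => //; rewrite eq_sym dart_neq.
Qed.

(** Flags are encoded as darts: (x, b) is the dart from x to the next point of
    b in the prescribed orientation. The reversed darts are those of the outer
    faces. *)
Definition pos d := o (dart_block d) (tail d) == head d.

Lemma pos_rev d : pos (rev_dart d) = ~~ pos d.
Proof.
rewrite /pos dart_block_rev; have [dB td hd] := dart_blockP d.
exact/orient_eq/dart_neq.
Qed.

Lemma pos_inj d e : pos d -> pos e -> tail d = tail e ->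
  dart_block d = dart_block e -> d = e.
Proof.
by move=> /eqP dh /eqP eh Et Eb; apply: dart_inj; rewrite // -dh -eh Et Eb.
Qed.

Lemma flag_dart b x : b \in B -> x \in b ->
  exists d, [/\ pos d, tail d = x, head d = o b x & dart_block d = b].
Proof.
move=> bB xb; have ox := orient_in bB xb.
have xox : x != o b x.
  by have := orient_uniq bB xb; rewrite /= !inE negb_or => /andP[/andP[]].
have xy : adj B (x, o b x).1 (x, o b x).2 by rewrite adj_steiner.
have Eb : dart_block (Dart xy) = b by apply/esym/block_uniq.
by exists (Dart xy); split; rewrite // /pos Eb.
Qed.

(** The turn of the blocks, extended by the identity to the darts that are not
    flags. *)
Definition tau_fun d :=
  if pos d then insubd d (head d, o (dart_block d) (head d)) else d.

Lemma tau_funP d : pos d ->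
  [/\ pos (tau_fun d), tail (tau_fun d) = head d &
      dart_block (tau_fun d) = dart_block d].
Proof.
move=> pd; have [dB _ hd] := dart_blockP d.
have [e [pe te he be]] := flag_dart dB hd.
suff -> : tau_fun d = e by rewrite pe te be.
rewrite /tau_fun pd -he -te; apply: val_inj; rewrite val_insubd.
by case: e {pe te he be} => -[x y] xy; rewrite /= xy.
Qed.

Lemma tau_fun3 d : tau_fun (tau_fun (tau_fun d)) = d.
Proof.
have [pd|/negPf npd] := boolP (pos d); last by rewrite /tau_fun !npd.
have [p1 t1 b1] := tau_funP pd; have [p2 t2 b2] := tau_funP p1.
have [p3 t3 b3] := tau_funP p2; apply: pos_inj => //; last by rewrite b3 b2 b1.
have [dB td _] := dart_blockP d.
rewrite t3 -(eqP p2) t2 -(eqP p1) t1 -(eqP pd) b2 b1.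
exact: orient3.
Qed.

Lemma tau_fun_inj : injective tau_fun.
Proof. exact: (can_inj (g := tau_fun \o tau_fun) tau_fun3). Qed.

Definition tau : {perm dart B} := perm tau_fun_inj.

Lemma tauP d : pos d ->
  [/\ pos (tau d), tail (tau d) = head d & dart_block (tau d) = dart_block d].
Proof.
move=> pd; have -> : tau d = tau_fun d by exact: permE.
exact: tau_funP.
Qed.

Lemma tau_neg d : ~~ pos d -> tau d = d.
Proof. by rewrite [tau d]permE /tau_fun => /negPf->. Qed.

Definition block_darts b : {set dart B} := [set d | pos d & dart_block d == b].

Lemma porbit_tau d : pos d -> porbit tau d = block_darts (dart_block d).
Proof.
move=> pd; have [dB td hd] := dart_blockP d.
have iterP i : [/\ pos ((tau ^+ i)%g d),
    tail ((tau ^+ i)%g d) = (o (dart_block d) ^+ i)%g (tail d) &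
    dart_block ((tau ^+ i)%g d) = dart_block d].
  elim: i => [|i [pi ti bi]]; first by rewrite !expg0 !perm1.
  rewrite !expgSr !permM; have [-> -> ->] := tauP pi; split=> //.
  by rewrite -(eqP pi) ti bi.
apply/setP => e; rewrite inE; apply/porbitP/andP => [[i ->]|[pe /eqP be]].
  by have [-> _ ->] := iterP i; rewrite eqxx.
have [_ te _] := dart_blockP e; have [_ ob] := oP dB.
move: te; rewrite be -(ob _ td) => /porbitP[i te]; exists i.
by have [pi ti bi] := iterP i; apply: pos_inj; rewrite // ?te ?be.
Qed.

(** * The embedding *)

Let P : {set dart B} := [set d | pos d].

(** The tree grows in three stages: the edges at u, then the other edges of
    the star, each the first one at its point, then the edges given by
    even_selection. The assumption provides a block through u to start from. *)
Lemma one_face_pos (u w : V) : u != w -> one_face (@tail V B) tau P P.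
Proof.
move=> uw; have [uwB u_uw _] := blockP SB uw.
have [f1 [pf1 tf1 _ bf1]] := flag_dart uwB u_uw.
pose star := [set d | pos d & u \in dart_block d].
have stage1 : one_face (@tail V B) tau [set d | pos d & tail d == u] star.
  have := one_face_forest
    (C := [set d | [&& pos d, tail d == u & dart_block d != dart_block f1]])
    (one_face_start (@tail V B) tau f1).
  rewrite porbit_tau //.
  set C := [set d | [&& _, _ & _]]; set A := _ :|: C; set Z := _ :|: _.
  have -> : A = [set d | pos d & tail d == u].
    apply/setP => d; rewrite !inE; apply/orP/andP => [[/eqP->|/and3P[]]//|].
      by rewrite pf1 tf1.
    move=> [pd td]; rewrite pd td /=.
    have [bd|] := eqVneq (dart_block d) (dart_block f1); [left|by right].
    by apply/eqP/pos_inj; rewrite ?tf1 ?(eqP td).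
  have -> : Z = star.
    apply/setP => d; rewrite !inE; apply/orP/andP => [[]|[pd ud]].
    - by move=> /andP[-> /eqP->]; rewrite bf1.
    - move=> /bigcupP[e]; rewrite inE => /and3P[pe /eqP te _].
      rewrite porbit_tau // inE => /andP[-> /eqP->].
      by rewrite -te; have [] := dart_blockP e.
    have [bd|bd] := eqVneq (dart_block d) (dart_block f1).
      by left; rewrite pd.
    right; have [dB _ _] := dart_blockP d.
    have [e [pe te _ be]] := flag_dart dB ud.
    apply/bigcupP; exists e; first by rewrite inE pe te be eqxx.
    by rewrite porbit_tau // inE pd be eqxx.
  apply=> [f|f f'].
    rewrite !inE => /and3P[pf /eqP tf /negPf bf].
    by rewrite bf andbF; split=> //; exists f1; rewrite ?inE ?tf.
  rewrite !inE => /and3P[pf /eqP tf _] /and3P[pf' /eqP tf' _].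
  rewrite porbit_tau // inE => /andP[_ /eqP bf].
  by apply: pos_inj; rewrite ?tf ?tf'.
have star_flag (f : dart B) : exists2 g, g \in star & tail f = tail g.
  have [_ tf _] := dart_blockP f.
  have [->|tu] := eqVneq (tail f) u; first by exists f1; rewrite // inE pf1 bf1.
  have [bB tb ub] := blockP SB tu; have [g [pg tg _ bg]] := flag_dart bB tb.
  by exists g; rewrite // inE pg bg.
have stage2 : one_face (@tail V B) tau star star.
  have := one_face_new_points (C := [set d in star | tail d != u]) stage1.
  set A := _ :|: _; have -> : A = star.
    apply/setP => d; rewrite !inE; have [<-|] := eqVneq (tail d) u.
      by have [_ -> _] := dart_blockP d; rewrite !andbT andbF orbF.
    by rewrite andbF andbT.
  apply; first by apply/subsetP => d; rewrite inE => /andP[].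
  move=> f g; rewrite !inE => /andP[/andP[pf uf] tfu] /andP[pg ug] tfg.
  apply: pos_inj => //; have [fB tf _] := dart_blockP f.
  have [gB tg _] := dart_blockP g.
  by rewrite (block_uniq SB fB tf uf tfu) (block_uniq SB gB tg ug) -?tfg.
have [a [aB even_a]] := even_selection SB u.
pose A := [set d | pos d &
  (u \in dart_block d) || (tail d == a (dart_block d))].
have stage3 : one_face (@tail V B) tau A P.
  have := one_face_forest (C := [set d | [&& pos d, u \notin dart_block d &
    tail d == a (dart_block d)]]) stage2.
  set C := [set d | [&& _, _ & _]]; set Z := _ :|: \bigcup_(f in C) _.
  have -> : star :|: C = A.
    apply/setP => d; rewrite !inE.
    by case: (pos d); case: (u \in dart_block d).
  have -> : Z = P.
    apply/setP => d; rewrite !inE; apply/orP/idP => [[/andP[]//|]|pd].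
      move=> /bigcupP[e]; rewrite inE => /and3P[pe _ _].
      by rewrite porbit_tau // inE => /andP[].
    have [ud|ud] := boolP (u \in dart_block d); first by left; rewrite pd.
    have [dB _ _] := dart_blockP d; have ad : a (dart_block d) \in dart_block d.
      by apply: aB; rewrite inE dB.
    have [e [pe te _ be]] := flag_dart dB ad; right.
    apply/bigcupP; exists e; first by rewrite inE pe be ud te eqxx.
    by rewrite porbit_tau // inE pd be eqxx.
  apply=> [f|f f'].
    rewrite !inE => /and3P[pf uf _]; rewrite (negPf uf) andbF; split=> //.
  rewrite !inE => /and3P[pf uf /eqP tf] /and3P[pf' _ /eqP tf'].
  rewrite porbit_tau // inE => /andP[_ /eqP bf].
  by apply: pos_inj; rewrite ?tf ?tf' ?bf.
apply: one_face_complete stage3 _ _.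
  move=> f _; have [g] := star_flag f; rewrite inE => /andP[pg ug] tfg.
  by exists g; rewrite // inE pg ug.
move=> f; suff -> : #|[set h in P :\: A | tail h == tail f]| =
    cotree_deg [set b in B | u \notin b] a (tail f) by [].
rewrite -(card_in_imset (f := dart_block)) => [|h h']; last first.
  rewrite !inE => /andP[/andP[_ ph] /eqP th] /andP[/andP[_ ph'] /eqP th'].
  by apply: pos_inj; rewrite ?th ?th'.
congr #|pred_of_set _|; apply/setP => b; rewrite !inE.
apply/imsetP/andP => [[h]|[/andP[bB ub] /andP[fb ab]]].
  rewrite !inE => /andP[/andP[+ ph] /eqP <-] ->.
  have [hB th _] := dart_blockP h.
  by rewrite ph /= negb_or eq_sym => /andP[-> ->]; rewrite hB th.
have [h [ph th _ bh]] := flag_dart bB fb; exists h => //.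
by rewrite !inE ph bh th eqxx (negPf ub) /= eq_sym ab.
Qed.

Lemma upper_embedding_exists (u w : V) : u != w ->
  exists E : embedding B,
    upper_embedding E /\ forall b, b \in B -> induces E b (o b).
Proof.
move=> uw; have [rho [_ [rhoP rhoN] oneP]] := one_face_pos uw.
have tauV d : pos (tau^-1%g d) = pos d.
  have [pd|npd] := boolP (pos d).
    have [//|npt] := boolP (pos (tau^-1%g d)).
    by have := tau_neg npt; rewrite permKV => Ed; rewrite -Ed pd in npt.
  by rewrite -{1}(tau_neg npd) permK (negPf npd).
have rho_flag d : pos d -> pos (rho d) /\ tail (rho d) = tail d.
  move=> pd; have dP : d \in P by rewrite inE.
  have : rho d \in porbit rho d by rewrite porbit_step porbit_id.
  by rewrite rhoP // !inE => /andP[-> /eqP].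
(* At a point x, the dart d of a flag (x, b) is followed by the other dart of
   b at x, which is the reverse of tau^-1 d, and this one by the dart rho d of
   the next flag at x. Since tau and rho fix the darts that are not flags, the
   single formula covers both cases. *)
pose rot := (tau^-1 * rev_perm B * (tau * rho))%g.
have rot_pos d : pos d -> rot d = rev_dart (tau^-1%g d).
  move=> pd; rewrite /rot !permM [rev_perm B _]permE.
  have npr : ~~ pos (rev_dart (tau^-1%g d)) by rewrite pos_rev tauV pd.
  by rewrite (tau_neg npr) rhoN // inE.
have rot_neg d : ~~ pos d -> rot d = rho (tau (rev_dart d)).
  move=> npd; rewrite /rot !permM [rev_perm B _]permE.
  by rewrite -{1}(tau_neg npd) permK.
have tail_rot d : tail (rot d) = tail d.
  have [pd|npd] := boolP (pos d).
    rewrite rot_pos //; have pt : pos (tau^-1%g d) by rewrite tauV.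
    by have [_ + _] := tauP pt; rewrite permKV => ->.
  have pr : pos (rev_dart d) by rewrite pos_rev.
  have [pt tt _] := tauP pr.
  by rewrite rot_neg //; have [_ ->] := rho_flag _ pt.
have rot_neg_pos d : ~~ pos d -> pos (rot d).
  move=> npd; have pr : pos (rev_dart d) by rewrite pos_rev.
  by rewrite rot_neg //; have [pt _ _] := tauP pr; have [] := rho_flag _ pt.
have rot2 d : pos d -> rot (rot d) = rho d.
  move=> pd; rewrite (rot_pos _ pd) rot_neg ?pos_rev ?tauV ?pd //.
  by rewrite rev_dartK permKV.
have rot_cyc d d' : (d' \in porbit rot d) = (tail d' == tail d).
  apply/idP/eqP => [|Et].
    move=> /porbitP[i ->]; elim: i => [|i IHi]; first by rewrite expg0 perm1.
    by rewrite expgSr permM tail_rot.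
  have flag_orbit e e' : pos e -> pos e' -> tail e' = tail e ->
      e' \in porbit rot e.
    move=> pe pe' te; have eP : e \in P by rewrite inE.
    have : e' \in porbit rho e by rewrite rhoP // !inE pe' te eqxx.
    apply/subsetP; apply: subset_trans (_ : porbit rot e :&: P \subset _).
      apply: porbit_sub => [z|]; last by rewrite inE porbit_id.
      rewrite !inE => /andP[zo pz]; have [-> _] := rho_flag _ pz.
      by rewrite -rot2 // !porbit_step zo.
    exact: subsetIl.
  have [e [pe oe te]] : exists e, [/\ pos e, porbit rot e = porbit rot d &
      tail e = tail d].
    have [pd|npd] := boolP (pos d); first by exists d.
    exists (rot d); split; rewrite ?tail_rot ?rot_neg_pos //.
    by apply/eqP; rewrite eq_porbit_mem porbit_step porbit_id.
  rewrite -oe -te in Et *; have [pd'|npd'] := boolP (pos d').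
    exact: flag_orbit.
  by rewrite -porbit_step flag_orbit ?rot_neg_pos ?tail_rot.
have Kconn : connected_graph (adj B).
  split; first by apply/card_gt0P; exists u.
  move=> x y; have [->|xy] := eqVneq x y; first exact: connect0.
  by apply: connect1; rewrite adj_steiner.
pose E0 := Build_cellular_embedding Kconn rot_cyc.
have faceE d : face_perm E0 d = rot^-1%g (rev_dart d).
  by rewrite permM [rev_perm B d]permE.
have face_pos d : pos d -> face_perm E0 d = tau d.
  move=> pd; have [pt _ _] := tauP pd.
  by rewrite faceE; apply: (canLR (permK _)); rewrite rot_pos // permK.
have face_neg d : ~~ pos d ->
    face_perm E0 d = rev_dart ((tau * rho)^-1%g (rev_dart d)).
  move=> npd; have pr : pos (rev_dart d) by rewrite pos_rev.
  rewrite faceE; apply: (canLR (permK _)); rewrite rot_neg.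
    by rewrite rev_dartK -[RHS](permM tau rho) permKV.
  have rP : rev_dart d \in P by rewrite inE.
  have : (tau * rho)^-1%g (rev_dart d) \in P.
    by rewrite -(oneP _ rP) -porbitV porbit_step porbit_id.
  by rewrite inE pos_rev negbK.
(* Reversal conjugates the face permutation on the outer darts to the inverse
   of tau * rho on the flags. *)
have outer d : ~~ pos d -> porbit (face_perm E0) d = ~: P.
  move=> npd; have rP : rev_dart d \in P by rewrite inE pos_rev.
  have iterE i : (face_perm E0 ^+ i)%g d =
      rev_dart (((tau * rho)^-1 ^+ i)%g (rev_dart d)).
    elim: i => [|i IHi]; first by rewrite !expg0 !perm1 rev_dartK.
    rewrite !expgSr (permM _ (face_perm E0)) IHi face_neg ?rev_dartK.
      by rewrite [in RHS]permM.
    rewrite pos_rev negbK.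
    have : ((tau * rho)^-1 ^+ i)%g (rev_dart d) \in P.
      by rewrite -(oneP _ rP) -porbitV mem_porbit.
    by rewrite inE.
  apply/setP => e; have := porbitV (tau * rho) (rev_dart d).
  rewrite (oneP _ rP) => /setP/(_ (rev_dart e)).
  rewrite !inE pos_rev => <-; apply/porbitP/porbitP => -[i Ei]; exists i.
    by rewrite Ei iterE rev_dartK.
  by rewrite iterE -Ei rev_dartK.
have inner d : pos d -> porbit (face_perm E0) d = block_darts (dart_block d).
  move=> pd; rewrite -porbit_tau //; apply: eq_in_porbit => e.
  by rewrite porbit_tau // inE => /andP[pe _]; apply: face_pos.
have darts0 : (#|{: dart B}| == 0) = false.
  have uw' : adj B (u, w).1 (u, w).2 by rewrite adj_steiner.
  by apply/negbTE; rewrite -lt0n; apply/card_gt0P; exists (Dart uw').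
have faceP F : (F \in faces E0) = (F \in porbits (face_perm E0)).
  by rewrite /faces darts0.
have block_bounds b : b \in B -> bounds E0 b (block_darts b).
  move=> bB; have [x xb] : exists x, x \in b.
    by apply/card_gt0P; rewrite (card_block SB).
  have [d [pd td _ bd]] := flag_dart bB xb; split.
    by rewrite faceP -bd -inner // imset_f.
  have xb1 := orient_in bB xb; have xb2 := orient_in bB xb1.
  exists x, (o b x), (o b (o b x)); split; first exact: orient_uniq.
    by apply/setP => y; rewrite (mem_block_orient y bB xb) !inE orbA.
  apply/setP => -[y z]; rewrite !inE; apply/imsetP/idP => [[e]|yz].
    rewrite inE => /andP[/eqP pe /eqP be] [-> ->]; rewrite -pe be.
    have [_ te _] := dart_blockP e; move: te.
    rewrite be (mem_block_orient _ bB xb) !inE => /or3P[]/eqP->;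
      by rewrite ?orient3 // eqxx ?orbT.
  have [yb zy] : y \in b /\ z = o b y.
    by move: yz => /orP[/orP[]|] /eqP[-> ->]; rewrite ?orient3.
  have [e [pe te he be]] := flag_dart bB yb.
  by exists e; rewrite ?te ?he ?zy // inE pe be eqxx.
pose E := Build_embedding block_bounds; exists E; split.
  have [uwB u_uw _] := blockP SB uw.
  have [f1 [pf1 tf1 _ bf1]] := flag_dart uwB u_uw.
  rewrite /upper_embedding (_ : outer_faces E = [set ~: P]) ?cards1 //.
  apply/setP => F; rewrite in_setD faceP in_set1; apply/andP/eqP => [[]|->].
    move=> Fb /imsetP[d _ EF]; move: Fb; rewrite EF.
    have [pd|/outer->//] := boolP (pos d); rewrite inner //.
    have [dB _ _] := dart_blockP d; move/negP; case.
    by apply/imsetP; exists (dart_block d).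
  have npr : ~~ pos (rev_dart f1) by rewrite pos_rev pf1.
  split; last by rewrite -(outer _ npr) imset_f.
  apply/imsetP => -[b bB] /=; have [x xb] : exists x, x \in b.
    by apply/card_gt0P; rewrite (card_block SB).
  have [d [pd _ _ bd]] := flag_dart bB xb.
  by move=> /setP/(_ d); rewrite !inE pd bd eqxx.
move=> b bB d /=; rewrite inE => /andP[/eqP pd /eqP bd].
by rewrite tail_face_perm -bd.
Qed.
End Darts.

Theorem theorem1p1 (V : finType) (B : {set {set V}})
    (V_nonempty : 0 < #|V|)
    (B_steiner : steiner_triple_system B)
    (o : {set V} -> {perm V}) (o_orientation : triple_orientation B o) :
  exists E : embedding B,
    upper_embedding E /\ forall b, b \in B -> induces E b (o b).
Proof.
have /card_gt0P[u _] := V_nonempty.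
have [/pred0P V1|/pred0Pn[w uw]] := boolP (pred0b [pred w | u != w]);
  last first.
  exact: (upper_embedding_exists B_steiner o_orientation uw).
(* A single point in the sphere: no darts, and one face. *)
have eqV x : x = u by apply/esym/eqP; move: (V1 x) => /= /negbFE.
have no_block b : b \notin B.
  apply/negP => /(card_block B_steiner) card3.
  have := max_card (mem b); rewrite card3 (eq_card1 (x := u)) // => x.
  by rewrite !inE (eqV x) eqxx.
have no_dart : #|{: dart B}| = 0.
  apply: eq_card0 => d; have := dart_neq B_steiner d.
  by rewrite (eqV (tail d)) (eqV (head d)) eqxx.
have Kconn : connected_graph (adj B).
  by split=> // x y; rewrite (eqV x) (eqV y) connect0.
have rot_cyc (d d' : dart B) : (d' \in porbit 1%g d) = (tail d' == tail d).
  by have := card0_eq no_dart d; rewrite inE.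
pose E0 := Build_cellular_embedding Kconn rot_cyc.
have block_bounds b : b \in B -> bounds E0 b set0.
  by rewrite (negPf (no_block b)).
exists (Build_embedding block_bounds); split=> [|b]; last first.
  by rewrite (negPf (no_block b)).
rewrite /upper_embedding /outer_faces /faces no_dart eqxx.
rewrite (_ : [set _ | b in B] = set0) ?setD0 ?cards1 //.
apply/setP => F; rewrite inE; apply/imsetP => -[b].
by rewrite (negPf (no_block b)).
Qed.
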